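(* Let $n\ge 3$ be an integer, $p$ a prime number and let $G$ be the affine group $\mathbb{F}_p[x]^n\rtimes B(n,\mathbb{F}_p[x])$. Then $G$ is transitive, finite-state and state-closed of degree $p$; that is, $G$ is isomorphic to a state-closed, finite-state subgroup of $\mathrm{Aut}(\mathcal{T}_p)$ which acts transitively on the first level of the tree $\mathcal{T}_p$.
   Context: $B(n,\mathbb{F}_p[x])$ is the subgroup of $GL_n(\mathbb{F}_p[x])$ consisting of the matrices whose entries above the main diagonal (positions $(i,j)$ with $i<j$) belong to the ideal $(x-1)\mathbb{F}_p[x]$. Elements of $\mathbb{F}_p[x]^n$ are viewed as columns and the product in $\mathbb{F}_p[x]^n\rtimes B(n,\mathbb{F}_p[x])$ is $(v_1,b_1)(v_2,b_2)=(v_1+b_1v_2,\,b_1b_2)$. For an integer $k\ge 1$, $\mathcal{T}_k$ is the infinite regular one-rooted $k$-tree (every vertex has exactly $k$ descendants on the next level) and $\mathrm{Aut}(\mathcal{T}_k)$ is its group of level-preserving automorphisms. The first level is identified with $\{0,\ldots,k-1\}$, and every $g\in \mathrm{Aut}(\mathcal{T}_k)$ is written uniquely as $g=(g_0,\ldots,g_{k-1})\sigma$, where $\sigma$ is the permutation of the first level induced by $g$ and $g_i\in\mathrm{Aut}(\mathcal{T}_k)$ is the induced action on the subtree headed by the vertex $i$ (this subtree being identified with $\mathcal{T}_k$). The set of states $\mathcal{Q}(g)$ is defined recursively by $\mathcal{Q}(g)=\{g\}\cup\bigcup_i \mathcal{Q}(g_i)$ (the smallest set containing $g$ and closed under $h\mapsto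 h_i$). A subgroup $G\le\mathrm{Aut}(\mathcal{T}_k)$ is state-closed if $g_i\in G$ for all $g\in G$ and all $i$; it is finite-state if $\mathcal{Q}(g)$ is finite for every $g\in G$. *)

(* Defs.v *)
From HB Require Import structures.
From mathcomp Require Import all_boot all_fingroup all_algebra.
From mathcomp Require Import boolp classical_sets functions cardinality.

Set Implicit Arguments.
Unset Strict Implicit.
Unset Printing Implicit Defensive.

Import GRing.Theory.
Local Open Scope ring_scope.

Section Matrices.
Variables (n p : nat).
Local Notation Fpx := {poly 'F_p}.

(** Membership in $B(n, F_p[x])$; for prime [p], ['F_p] is the field of order
    [p], and an entry lies in the ideal $(x - 1)$ when ['X - 1] divides it. *)
Definition in_B : pred 'M[Fpx]_n := fun b =>
  (b \in unitmx)
  && [forall i : 'I_n, forall j : 'I_n, (i < j)%N ==> ('X - 1 %| b i j)].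

Lemma in_BP (b : 'M[Fpx]_n) :
  reflect (b \in unitmx /\ forall i j : 'I_n, (i < j)%N -> 'X - 1 %| b i j)
          (in_B b).
Proof.
apply: (iffP andP) => -[ub hb]; split=> //.
  by move=> i j ij; move/forallP/(_ i)/forallP/(_ j)/implyP: hb; apply.
by apply/forallP=> i; apply/forallP=> j; apply/implyP; apply: hb.
Qed.

Lemma in_B1 : in_B 1%:M.
Proof.
apply/in_BP; split; first exact: unitmx1.
by move=> i j ij; rewrite mxE -val_eqE (ltn_eqF ij) dvdp0.
Qed.

Lemma in_BM a b : in_B a -> in_B b -> in_B (a *m b).
Proof.
move=> /in_BP[ua ha] /in_BP[ub hb]; apply/in_BP; split.
  by rewrite unitmx_mul ua.
move=> i j ij; rewrite mxE; apply: (big_ind (fun q => 'X - 1 %| q)).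
- exact: dvdp0.
- by move=> q r; apply: dvdp_add.
- move=> k _; have [ik|ki] := ltnP i k; first by rewrite dvdp_mulr ?ha.
  by rewrite dvdp_mull ?hb // (leq_ltn_trans ki ij).
Qed.

Lemma dvdp_Xsub1 (q : Fpx) : ('X - 1 %| q) = (q.[1] == 0).
Proof. by rewrite -polyC1 dvdp_XsubCl. Qed.

Lemma in_BV b : in_B b -> in_B (invmx b).
Proof.
move=> /in_BP[ub hb]; apply/in_BP; split; first by rewrite unitmx_inv.
pose ev := horner_eval (1 : 'F_p).
pose A := map_mx ev b; pose C := map_mx ev (invmx b).
have AC : A *m C = 1%:M by rewrite -map_mxM mulmxV // map_mx1.
have hA (i j : 'I_n) : (i < j)%N -> A i j = 0.
  by move=> /hb; rewrite dvdp_Xsub1 => /eqP h; rewrite mxE /ev /= horner_evalE.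
have dA i : A i i != 0.
  have : \det A != 0.
    by apply: contraTneq (oner_neq0 'F_p) => A0; rewrite -(det1 'F_p n) -AC
       det_mulmx A0 mul0r eqxx.
  rewrite det_trig; last by apply/is_trig_mxP.
  by move/prodf_neq0; apply.
have CE i j : C i j = (invmx b i j).[1].
  by rewrite mxE /ev /= horner_evalE.
clearbody C; clearbody A.
have hC m (i j : 'I_n) : (i < m)%N -> (i < j)%N -> C i j = 0.
  elim: m i j => // m IHm i j im ij.
  have /matrixP/(_ i j) := AC.
  rewrite !mxE -val_eqE (ltn_eqF ij) (bigD1 i) //= big1 => [|k ki].
    by rewrite addr0 => /eqP; rewrite mulf_eq0 (negPf (dA i)) => /eqP.
  have [ik|ki'] := ltnP i k; first by rewrite hA ?mul0r.
  have {ki ki'}ki : (k < i)%N by rewrite ltn_neqAle ki' andbT val_eqE.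
  by rewrite (IHm k j (leq_trans ki im) (ltn_trans ki ij)) mulr0.
move=> i j ij; rewrite dvdp_Xsub1; apply/eqP.
by rewrite -CE (hC i.+1).
Qed.

Record B_group := BGroup { B_mx :> 'M[Fpx]_n; B_mxP : in_B B_mx }.

HB.instance Definition _ := [isSub for B_mx].
HB.instance Definition _ := [Choice of B_group by <:].

Definition B_one := BGroup in_B1.
Definition B_mul (a b : B_group) := BGroup (in_BM (B_mxP a) (B_mxP b)).
Definition B_inv (b : B_group) := BGroup (in_BV (B_mxP b)).

Lemma B_unit (b : B_group) : (b : 'M_n) \in unitmx.
Proof. by case/in_BP: (B_mxP b). Qed.

Lemma B_mulA : associative B_mul.
Proof. by move=> a b c; apply: val_inj; rewrite /= mulmxA. Qed.
Lemma B_mul1 : left_id B_one B_mul.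
Proof. by move=> b; apply: val_inj; rewrite /= mul1mx. Qed.
Lemma B_mulr1 : right_id B_one B_mul.
Proof. by move=> b; apply: val_inj; rewrite /= mulmx1. Qed.
Lemma B_mulV : left_inverse B_one B_inv B_mul.
Proof. by move=> b; apply: val_inj; rewrite /= mulVmx ?B_unit. Qed.
Lemma B_mulrV : right_inverse B_one B_inv B_mul.
Proof. by move=> b; apply: val_inj; rewrite /= mulmxV ?B_unit. Qed.

HB.instance Definition _ :=
  isGroup.Build B_group B_mulA B_mul1 B_mulr1 B_mulV B_mulrV.

Definition affine : Type := ('cV[Fpx]_n * B_group)%type.

HB.instance Definition _ := Choice.copy affine ('cV[Fpx]_n * B_group)%type.

Definition affine_one : affine := (0, 1%g).
Definition affine_mul (g h : affine) : affine :=
  (g.1 + (g.2 : 'M_n) *m h.1, (g.2 * h.2)%g).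
Definition affine_inv (g : affine) : affine :=
  (- ((g.2^-1)%g : 'M_n) *m g.1, (g.2^-1)%g).

Lemma affine_mulA : associative affine_mul.
Proof.
case=> [u a] [v b] [w c]; congr pair; last exact: mulgA.
by rewrite /= mulmxDr addrA mulmxA.
Qed.
Lemma affine_mul1 : left_id affine_one affine_mul.
Proof. by case=> u a; congr pair; rewrite /= ?mul1mx ?add0r ?mul1g. Qed.
Lemma affine_mulr1 : right_id affine_one affine_mul.
Proof. by case=> u a; congr pair; rewrite /= ?mulmx0 ?addr0 ?mulg1. Qed.
Lemma affine_mulV : left_inverse affine_one affine_inv affine_mul.
Proof. by case=> u a; congr pair; rewrite /= ?mulVg // mulNmx addNr. Qed.
Lemma affine_mulrV : right_inverse affine_one affine_inv affine_mul.
Proof.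
case=> u a; congr pair; rewrite /= ?mulgV // mulNmx mulmxN mulmxA.
by rewrite mulmxV ?B_unit // mul1mx subrr.
Qed.

HB.instance Definition _ :=
  isGroup.Build affine affine_mulA affine_mul1 affine_mulr1
    affine_mulV affine_mulrV.

End Matrices.

Section Tree.
Variable k : nat.

(** The vertices of $T_k$ are the words over ['I_k], a word of length [m] lying
    on level [m]; the descendants of [u] are the words having [u] as a prefix. *)
Definition tree_automorphism (f : seq 'I_k -> seq 'I_k) : Prop :=
  [/\ bijective f,
      forall u, size (f u) = size u
    & forall u v, prefix (f u) (f v) = prefix u v].

Record tree_aut := TreeAut {
  tree_fun :> seq 'I_k -> seq 'I_k;
  tree_funP : `[< tree_automorphism tree_fun >] }.

HB.instance Definition _ := [isSub for tree_fun].
HB.instance Definition _ := [Choice of tree_aut by <:].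

Lemma tree_autP (g : tree_aut) : tree_automorphism g.
Proof. exact/asboolP/tree_funP. Qed.

Lemma tree_aut_eq (g h : tree_aut) : g =1 h -> g = h.
Proof. by move=> gh; apply/val_inj/funext. Qed.

Lemma tree_one_subproof : `[< tree_automorphism id >].
Proof. by apply/asboolP; split=> //; exists id. Qed.

Lemma tree_mul_subproof (g h : tree_aut) : `[< tree_automorphism (g \o h) >].
Proof.
have [[bg sg pg] [bh sh ph]] := (tree_autP g, tree_autP h).
apply/asboolP; split=> [|u|u v]; first exact: bij_comp.
  by rewrite /= sg sh.
by rewrite /= pg ph.
Qed.

Lemma tree_inv_exists (g : tree_aut) :
  {h : tree_aut | cancel g h & cancel h g}.
Proof.
apply: cid2; have [[h gK hK] sg pg] := tree_autP g.
have hP : `[< tree_automorphism h >].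
  apply/asboolP; split=> [|u|u v]; first by exists g.
    by rewrite -sg hK.
  by rewrite -pg !hK.
by exists (TreeAut hP).
Qed.

Definition tree_one := TreeAut tree_one_subproof.
(** Using the opposite product would change neither the subgroups of
    $Aut(T_k)$, nor their isomorphism types, nor the states. *)
Definition tree_mul (g h : tree_aut) := TreeAut (tree_mul_subproof g h).
Definition tree_inv (g : tree_aut) : tree_aut :=
  let: exist2 h _ _ := tree_inv_exists g in h.

Lemma tree_invK (g : tree_aut) : cancel g (tree_inv g).
Proof. by rewrite /tree_inv; case: tree_inv_exists. Qed.
Lemma tree_invVK (g : tree_aut) : cancel (tree_inv g) g.
Proof. by rewrite /tree_inv; case: tree_inv_exists. Qed.

Lemma tree_mulA : associative tree_mul.
Proof. by move=> a b c; apply: tree_aut_eq. Qed.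
Lemma tree_mul1 : left_id tree_one tree_mul.
Proof. by move=> a; apply: tree_aut_eq. Qed.
Lemma tree_mulr1 : right_id tree_one tree_mul.
Proof. by move=> a; apply: tree_aut_eq. Qed.
Lemma tree_mulV : left_inverse tree_one tree_inv tree_mul.
Proof. by move=> a; apply: tree_aut_eq => u; apply: tree_invK. Qed.
Lemma tree_mulrV : right_inverse tree_one tree_inv tree_mul.
Proof. by move=> a; apply: tree_aut_eq => u; apply: tree_invVK. Qed.

HB.instance Definition _ :=
  isGroup.Build tree_aut tree_mulA tree_mul1 tree_mulr1 tree_mulV tree_mulrV.

(** The permutation of the first level induced by [g]; the default value of
    [head] is irrelevant, since [g [:: i]] has length one. *)
Definition level1_fun (g : tree_aut) (i : 'I_k) : 'I_k := head i (g [:: i]).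

Lemma level1_funE (g : tree_aut) i : g [:: i] = [:: level1_fun g i].
Proof.
rewrite /level1_fun; have [_ sg _] := tree_autP g.
by have := sg [:: i]; case: (g [:: i]) => [|j []].
Qed.

Lemma level1_inj (g : tree_aut) : injective (level1_fun g).
Proof.
move=> i j ij; have [/bij_inj g_inj _ _] := tree_autP g.
suff: [:: i] = [:: j] by case.
by apply: g_inj; rewrite !level1_funE ij.
Qed.

Definition level1 (g : tree_aut) : {perm 'I_k} := perm (@level1_inj g).

Lemma tree_fun_cons (g : tree_aut) i w :
  g (i :: w) = level1 g i :: behead (g (i :: w)).
Proof.
have [_ _ pg] := tree_autP g.
have := pg [:: i] (i :: w); rewrite permE level1_funE prefix_cons prefix0s eqxx.
by case: (g (i :: w)) => [|j s] //=; rewrite prefix0s andbT => /eqP ->.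
Qed.

Lemma state_subproof (g : tree_aut) (i : 'I_k) :
  `[< tree_automorphism (fun w => behead (g (i :: w))) >].
Proof.
have [_ sg pg] := tree_autP g; apply/asboolP; split=> [|w|u v].
- exists (fun w => behead (tree_inv g (level1 g i :: w))) => w.
    by rewrite -tree_fun_cons tree_invK.
  have e : level1 (tree_inv g) (level1 g i) = i.
    by have := tree_invK g [:: i]; rewrite !level1_funE !permE => -[].
  have := tree_fun_cons (tree_inv g) (level1 g i) w; rewrite e => <-.
  by rewrite tree_invVK.
- by rewrite size_behead sg.
- have := pg (i :: u) (i :: v).
  by rewrite (tree_fun_cons g i u) (tree_fun_cons g i v) /= !eqxx.
Qed.

(** The automorphism $g_i$ in $g = (g_0, ..., g_{k-1}) \sigma$. *)
Definition state (g : tree_aut) (i : 'I_k) : tree_aut :=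
  TreeAut (state_subproof g i).

Lemma tree_decomposition (g : tree_aut) i w :
  g (i :: w) = level1 g i :: state g i w.
Proof. exact: tree_fun_cons. Qed.

Inductive states (g : tree_aut) : set tree_aut :=
| states_self : states g g
| states_step h i : states g h -> states g (state h i).

Definition state_closed (H : set tree_aut) : Prop :=
  forall g i, H g -> H (state g i).

Definition finite_state (H : set tree_aut) : Prop :=
  forall g, H g -> finite_set (states g).

Definition transitive_level1 (H : set tree_aut) : Prop :=
  forall i j, exists2 g, H g & level1 g i = j.

End Tree.

Definition isomorphic_to_subset (G A : groupType) (H : set A) : Prop :=
  exists2 f : G -> A,
    {morph f : x y / (x * y)%g >-> (x * y)%g} & set_bij [set: G] H f.

(* Main.v *)
Require Import Defs.
From mathcomp Require Import all_boot all_fingroup all_algebra.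
From mathcomp Require Import boolp classical_sets functions cardinality.

(** Write t = x - 1, and let P be the matrix of the map
    (u_0, ..., u_(n-1)) |-> (t u_(n-1), u_0, ..., u_(n-2)) of F_p[x]^n, an n-th
    root of the scalar matrix t ([root_mx]). The image of P is the set of vectors
    whose first coordinate is divisible by t, so it has p cosets, represented by
    the vectors a e_0 with a in F_p; hence every vector is a e_0 + P u for
    a unique digit a and a unique u, and expanding u in turn identifies the
    quotients of F_p[x]^n by the images of P, P^2, ... with the levels of the
    p-regular tree.

    The image of P^k, for k at most n, consists of the vectors whose first k
    coordinates are divisible by t, and B is the group of the invertible matrices
    preserving all these submodules. As P shifts their chain, conjugation by P
    maps B into itself ([conj_root_B]). An affine map g of the group therefore
    permutes the cosets of the image of P and, read on each of them through
    u |-> a e_0 + P u, is again an affine map of the group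
    ([affine_map_branch]). As these coordinate changes are
    injective, this rule respects products, so that it is a wreath recursion,
    and unfolding it on words gives a homomorphism into Aut(T_p) whose range is
    state-closed ([wreath_recursion_range]). Translations by a e_0 make it
    transitive on the first level.

    It is finite-state because P^-1 does not raise degrees, while P^n is scalar:
    conjugating by P repeatedly keeps the degrees of a matrix bounded, and the
    states of g stay in a finite set of maps with bounded degrees
    ([bounded_st]).

    It is faithful ([kernel_trivial]): if g acts trivially then so do all its
    states, so the translation part of g lies in the image of every P^r and
    vanishes. Conjugating g by the translation by u gives another element of the
    kernel, with translation part u - b u where b is the linear part of g;
    hence b = 1. *)

Set Implicit Arguments.
Unset Strict Implicit.
Unset Printing Implicit Defensive.

Import GRing.Theory.

(** * Tree automorphisms from a wreath recursion *)

Section WreathRecursion.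

Variables (k : nat) (G : groupType).
Variables (out : G -> 'I_k -> 'I_k) (st : G -> 'I_k -> G).

Local Open Scope group_scope.

(** The product rule (g h)_i = g_(h i) h_i of automorphisms written as
    (g_0, ..., g_(k-1)) sigma, stated for abstract data [out] and [st] playing
    the parts of sigma and of the g_i. *)
Definition wreath_recursion : Prop :=
  [/\ forall i, out 1 i = i,
      forall g h i, out (g * h) i = out g (out h i)
    & forall g h i, st (g * h) i = st g (out h i) * st h i].

Hypothesis wr : wreath_recursion.

Fixpoint word_act (g : G) (w : seq 'I_k) : seq 'I_k :=
  if w is i :: w' then out g i :: word_act (st g i) w' else [::].

(** The product rule makes [st 1 i] an idempotent. *)
Lemma st1 i : st 1 i = 1.
Proof.
case: wr => o1 _ sM; have := sM 1 1 i.
by rewrite mulg1 o1 => e; apply: (mulgI (st 1 i)); rewrite -e mulg1.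
Qed.

Lemma word_act1 w : word_act 1 w = w.
Proof. by case: wr => o1 _ _; elim: w => //= i w IHw; rewrite st1 o1 IHw. Qed.

Lemma word_actM g h w : word_act (g * h) w = word_act g (word_act h w).
Proof.
case: wr => _ oM sM.
by elim: w g h => //= i w IHw g h; rewrite sM oM IHw.
Qed.

Lemma word_actK g : cancel (word_act g) (word_act g^-1).
Proof. by move=> w; rewrite -word_actM mulVg word_act1. Qed.

Lemma out_inj g : injective (out g).
Proof.
case: wr => o1 oM _; apply: (can_inj (g := out g^-1)) => i.
by rewrite -oM mulVg o1.
Qed.

Lemma word_act_subproof g : `[< tree_automorphism (word_act g) >].
Proof.
apply/asboolP; split.
- exists (word_act g^-1); first exact: word_actK.
  by move=> w; rewrite -word_actM mulgV word_act1.
- by move=> u; elim: u g => //= i u IHu g; rewrite IHu.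
- move=> u v; elim: u v g => [|i u IHu] [|j v] g //=.
  rewrite (inj_eq (@out_inj g)); case: eqP => //= ->.
  exact: IHu.
Qed.

Definition tree_act (g : G) : tree_aut k := TreeAut (word_act_subproof g).

Lemma tree_act1 : tree_act 1 = 1.
Proof. by apply: tree_aut_eq => w; apply: word_act1. Qed.

Lemma tree_actM : {morph tree_act : g h / g * h}.
Proof. by move=> g h; apply: tree_aut_eq => w; apply: word_actM. Qed.

Lemma tree_actV : {morph tree_act : g / g^-1}.
Proof.
move=> g; apply: (mulgI (tree_act g)).
by rewrite -tree_actM !mulgV tree_act1.
Qed.

Lemma level1_act g i : level1 (tree_act g) i = out g i.
Proof. by rewrite permE. Qed.

Lemma state_act g i : state (tree_act g) i = tree_act (st g i).
Proof. exact: tree_aut_eq. Qed.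

Lemma states_act (S : set G) g :
  S g -> (forall h i, S h -> S (st h i)) ->
  (states (tree_act g) `<=` tree_act @` S)%classic.
Proof.
move=> Sg Sst a; elim=> {a} [|_ i _ [h Sh <-]]; first by exists g.
by rewrite state_act; exists (st h i) => //; apply: Sst.
Qed.

Lemma act1_out g i : tree_act g = 1 -> out g i = i.
Proof. by move=> g1; rewrite -level1_act g1 permE. Qed.

(** The kernel of the action is closed under taking states: the states of the
    identity are the identity. *)
Lemma act1_st g i : tree_act g = 1 -> tree_act (st g i) = 1.
Proof. by move=> g1; rewrite -state_act g1; apply: tree_aut_eq. Qed.

Lemma tree_act_inj : (forall g, tree_act g = 1 -> g = 1) -> injective tree_act.
Proof.
move=> ker1 g h gh; apply: (mulIg h^-1); rewrite mulgV; apply: ker1.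
by rewrite tree_actM gh -tree_actM mulgV tree_act1.
Qed.

(** Whatever the group, realising it as in the conclusion amounts to finding
    a wreath recursion with trivial kernel, with finite invariant sets around
    every element, and transitive on letters. *)
Lemma wreath_recursion_range :
  (forall g, tree_act g = 1 -> g = 1) ->
  (forall g, exists S : set G,
     [/\ S g, forall h i, S h -> S (st h i) & finite_set S]) ->
  (forall i j, exists g, out g i = j) ->
  exists H : set (tree_aut k),
    [/\ group_closed [in H],
        state_closed H,
        finite_state H,
        transitive_level1 H
      & isomorphic_to_subset G H].
Proof.
move=> ker1 fin_st trans; exists (range tree_act); split.
- split; first by apply/mem_set; exists 1; rewrite ?tree_act1.
  move=> _ _ /set_mem[g _ <-] /set_mem[h _ <-]; apply/mem_set.
  by exists (g * h^-1); rewrite // tree_actM tree_actV.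
- by move=> _ i [g _ <-]; exists (st g i); rewrite ?state_act.
- move=> _ [g _ <-]; have [S [Sg Sst finS]] := fin_st g.
  by apply: sub_finite_set (states_act Sg Sst) _; apply: finite_image.
- move=> i j; have [g <-] := trans i j.
  by exists (tree_act g); [exists g | rewrite level1_act].
- exists tree_act; first exact: tree_actM.
  split; [by move=> g _; exists g | | by []].
  by move=> g h _ _; apply: tree_act_inj.
Qed.

End WreathRecursion.

Local Open Scope ring_scope.

(** * A root of the scalar matrix X - 1 normalising B *)

Section Root.

Variables (m p : nat).
Local Notation n := m.+1.
Local Notation Fpx := {poly 'F_p}.
Local Notation t := ('X - 1 : Fpx).

(** The weights of the cyclic shift e_i |-> wt i * e_(i+1): only the step that
    wraps around carries a factor x - 1. *)
Definition wt (i : 'I_n) : Fpx := if i == ord_max then t else 1.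

Definition root_mx : 'M[Fpx]_n := \matrix_(i, j) (wt j *+ (i == ordS j)).

Lemma X1_neq0 : t != 0.
Proof. by rewrite -polyC1 polyXsubC_eq0. Qed.

Lemma wt_neq0 i : wt i != 0.
Proof. by rewrite /wt; case: ifP => _; rewrite ?X1_neq0 ?oner_eq0. Qed.

Lemma ordS_max : ordS (ord_max : 'I_n) = ord0.
Proof. by apply: val_inj; rewrite /= modnn. Qed.

Lemma ordS_lt (i : 'I_n) : i != ord_max -> ordS i = i.+1 :> nat.
Proof.
move=> ne; rewrite /= modn_small // ltn_neqAle ltn_ord andbT.
by rewrite eqSS -[m]/(val (ord_max : 'I_n)) val_eqE.
Qed.

Lemma mul_root_mx q (A : 'M_(n, q)) i j :
  (root_mx *m A) (ordS i) j = wt i * A i j.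
Proof.
rewrite mxE (bigD1 i) //= big1 => [|l li]; rewrite mxE.
  by rewrite eqxx addr0.
by rewrite (inj_eq (can_inj (@ordSK n))) eq_sym (negPf li) mul0r.
Qed.

Lemma mulmx_root q (A : 'M_(q, n)) i j :
  (A *m root_mx) i j = A i (ordS j) * wt j.
Proof.
rewrite mxE (bigD1 (ordS j)) //= big1 => [|l li]; rewrite mxE.
  by rewrite eqxx addr0.
by rewrite (negPf li) mulr0.
Qed.

Lemma root_mxI q : injective (mulmx root_mx : 'M_(n, q) -> 'M_(n, q)).
Proof.
move=> A C /matrixP AC; apply/matrixP => i j; apply: (mulfI (wt_neq0 i)).
by rewrite -!mul_root_mx.
Qed.

Lemma root_mx_row0 q (A : 'M_(n, q)) j : t %| (root_mx *m A) 0 j.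
Proof.
by rewrite -[0 : 'I_n]/(ord0 : 'I_n) -ordS_max mul_root_mx /wt eqxx dvdp_mulr.
Qed.

(** The inverse of [root_mx] applied to [A]; the quotients are exact when the
    first row of [A] is divisible by x - 1. *)
Definition div_root q (A : 'M[Fpx]_(n, q)) : 'M[Fpx]_(n, q) :=
  \matrix_(i, j) (A (ordS i) j %/ wt i).

Lemma div_rootK q (A : 'M_(n, q)) :
  (forall j, t %| A 0 j) -> root_mx *m div_root A = A.
Proof.
move=> tA; apply/matrixP => i j; rewrite -(ord_predK i) mul_root_mx mxE.
rewrite mulrC divpK // /wt; case: eqP => [->|_]; last exact: dvd1p.
by rewrite ordS_max.
Qed.

Definition conj_root (b : 'M[Fpx]_n) : 'M[Fpx]_n := div_root (b *m root_mx).

Lemma conj_rootE b i j : conj_root b i j = (b (ordS i) (ordS j) * wt j) %/ wt i.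
Proof. by rewrite mxE mulmx_root. Qed.

(** The first row of [b *m root_mx] is divisible by x - 1: its entries are
    [b 0 j] for [j] positive, and [b 0 0] multiplied by x - 1. *)
Lemma conj_rootP b : in_B b -> root_mx *m conj_root b = b *m root_mx.
Proof.
case/in_BP => _ tb; apply: div_rootK => j; rewrite mulmx_root /wt.
have [->|jm] := eqVneq; first by rewrite dvdp_mull.
by rewrite dvdp_mulr // tb // (ordS_lt jm).
Qed.

(** Conjugation moves the entry (i + 1, j + 1) to (i, j), indices being taken
    modulo the dimension. Above the diagonal this either leaves an entry above
    the diagonal, or fills the last column, where a factor x - 1 appears.
    Conjugating the inverse gives the inverse of the conjugate. *)
Lemma conj_root_B b : in_B b -> in_B (conj_root b).
Proof.
move=> Bb; apply/in_BP; split.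
  have ub : b \in unitmx by case/in_BP: Bb.
  suff: conj_root b *m conj_root (invmx b) = 1%:M by case/mulmx1_unit.
  apply: root_mxI; rewrite mulmxA conj_rootP // -mulmxA conj_rootP ?in_BV //.
  by rewrite mulmxA mulmxV // mul1mx mulmx1.
move=> i j ij; have im : i != ord_max.
  by rewrite -val_eqE /= ltn_eqF // (leq_trans ij) // -ltnS.
rewrite conj_rootE /wt (negPf im) divp1.
have [->|jm] := eqVneq; first by rewrite dvdp_mull.
case/in_BP: Bb => _ tb; rewrite dvdp_mulr // tb //.
by rewrite (ordS_lt im) (ordS_lt jm) ltnS.
Qed.

Lemma size_X1 : size t = 2.
Proof. by rewrite -polyC1 size_XsubC. Qed.

Lemma size_div_root q (A : 'M[Fpx]_(n, q)) d :
  (forall i j, (size (A i j) <= d)%N) ->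
  forall i j, (size (div_root A i j) <= d)%N.
Proof. by move=> sA i j; rewrite mxE (leq_trans (leq_divp _ _)). Qed.

(** Conjugation by [root_mx] multiplies by x - 1 an entry that comes from below
    the diagonal and goes above it, and divides by x - 1 an entry making the
    opposite move. Granting one more degree above the diagonal makes the bound
    invariant. *)
Definition size_le d (b : 'M[Fpx]_n) : Prop :=
  forall i j, (size (b i j) <= d + (i < j))%N.

Lemma size_conj_root d b : size_le d b -> size_le d (conj_root b).
Proof.
move=> sb i j; rewrite conj_rootE; have := sb (ordS i) (ordS j).
have lt_max (l : 'I_n) : l != ord_max -> (l < m)%N.
  by move=> lm; have := ltn_ord (ordS l); rewrite (ordS_lt lm).
rewrite /wt; case: (eqVneq i) => [->|im]; case: (eqVneq j) => [->|jm].
- by rewrite mulpK ?X1_neq0 // ordS_max !ltnn.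
- rewrite mulr1 ordS_max (ordS_lt jm) addn1 [(ord_max < j)%N]ltnNge leq_ord.
  by rewrite addn0 size_divp ?X1_neq0 // size_X1 leq_subLR add1n.
- rewrite divp1 ordS_max ltn0 addn0 lt_max // addn1 => s.
  have [->|nz] := eqVneq (b (ordS i) ord0) 0; first by rewrite mul0r size_poly0.
  by rewrite size_mul ?X1_neq0 // size_X1 addn2 /= ltnS.
- by rewrite mulr1 divp1 (ordS_lt im) (ordS_lt jm) ltnS.
Qed.

(** * The wreath recursion of the affine group *)

Local Notation aff := (affine n p).

Definition conjB (b : B_group n p) : B_group n p :=
  BGroup (conj_root_B (B_mxP b)).

Definition affine_map (g : aff) (u : 'cV[Fpx]_n) : 'cV_n :=
  g.1 + (g.2 : 'M_n) *m u.

Lemma affine_mapM g h u :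
  affine_map (g * h)%g u = affine_map g (affine_map h u).
Proof. by rewrite /affine_map /= mulmxDr addrA mulmxA. Qed.

(** The affine group acts faithfully on vectors, so identities between its
    elements can be checked on points. *)
Lemma affine_map_inj g h : affine_map g =1 affine_map h -> g = h.
Proof.
case: g h => [u a] [v b] gh; have := gh 0.
rewrite /affine_map /= !mulmx0 !addr0 => uv; congr pair => //.
apply: val_inj; apply/matrixP => i j.
have /matrixP/(_ i 0) := gh (delta_mx j 0).
by rewrite /affine_map /= uv -!colE !mxE => /addrI.
Qed.

Definition digit (a : 'F_p) : 'cV[Fpx]_n := a%:P *: delta_mx 0 0.

(** The chart of the coset of the image of [root_mx] labelled by [a]. *)
Definition branch (a : 'F_p) (u : 'cV[Fpx]_n) : 'cV_n := digit a + root_mx *m u.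

Lemma digit00 a : digit a 0 0 = a%:P.
Proof. by rewrite !mxE eqxx mulr1. Qed.

(** First coordinates in the image of [root_mx] vanish at 1, so the label of
    a coset is the value at 1 of the first coordinate of any of its points. *)
Lemma branch_digit a u : (branch a u 0 0).[1] = a.
Proof.
rewrite mxE digit00 hornerD hornerC.
by have := root_mx_row0 u 0; rewrite dvdp_Xsub1 => /eqP ->; rewrite addr0.
Qed.

Lemma branch_inj a c u v : branch a u = branch c v -> a = c /\ u = v.
Proof.
move=> e; have ac : a = c by rewrite -(branch_digit a u) e branch_digit.
by move: e; rewrite /branch ac => /addrI /root_mxI.
Qed.

(** The label of the coset onto which [g] sends the coset labelled by [a]. *)
Definition affine_out (g : aff) (a : 'F_p) : 'F_p :=
  (affine_map g (digit a) 0 0).[1].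

Definition affine_st (g : aff) (a : 'F_p) : aff :=
  (div_root (affine_map g (digit a) - digit (affine_out g a)), conjB g.2).

(** This intertwining relation determines [affine_out] and [affine_st], since
    charts are injective with disjoint images; the rules for products follow
    from it by composing affine maps. *)
Lemma affine_map_branch g a u :
  affine_map g (branch a u) =
  branch (affine_out g a) (affine_map (affine_st g a) u).
Proof.
rewrite /branch [in RHS]/affine_map /= mulmxDr div_rootK => [|j].
  rewrite mulmxA conj_rootP ?B_mxP // addrA subrKC -mulmxA.
  by rewrite /affine_map mulmxDr addrA.
rewrite ord1 dvdp_Xsub1 mxE [(- _ : 'M_(_, _)) 0 0]mxE digit00.
by rewrite hornerD hornerN hornerC subrr.
Qed.

Lemma affine_outM g h a :
  affine_out (g * h)%g a = affine_out g (affine_out h a).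
Proof.
have := affine_map_branch (g * h)%g a 0.
by rewrite affine_mapM !affine_map_branch => /branch_inj[].
Qed.

Lemma affine_stM g h a :
  affine_st (g * h)%g a =
  (affine_st g (affine_out h a) * affine_st h a)%g.
Proof.
apply: affine_map_inj => u; have := affine_map_branch (g * h)%g a u.
by rewrite affine_mapM !affine_map_branch affine_mapM => /branch_inj[].
Qed.

Lemma affine_out1 a : affine_out 1%g a = a.
Proof. by rewrite /affine_out /affine_map mul1mx add0r digit00 hornerC. Qed.

Definition bounded d : set aff :=
  [set g : aff | (forall i j, (size (g.1 i j) <= d)%N)
                /\ size_le d (g.2 : 'M_n)]%classic.

(** The translation part of a state is obtained from the one of [g] by adding
    constants and multiples of the first column of the linear part. No entry of
    that column lies above the diagonal, so it obeys the strict bound [d]; the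
    constants force [d] to be positive. *)
Lemma bounded_st d g a : (0 < d)%N -> bounded d g -> bounded d (affine_st g a).
Proof.
move=> d0 [sv sb]; split; last exact: size_conj_root.
have sC (c : 'F_p) (f : Fpx) : (size f <= d)%N -> (size (c%:P * f)%R <= d)%N.
  by move=> sf; rewrite mul_polyC (leq_trans (size_scale_leq _ _)).
have sD (f h : Fpx) :
    (size f <= d)%N -> (size h <= d)%N -> (size (f + h)%R <= d)%N.
  by move=> sf sh; rewrite (leq_trans (size_polyD _ _)) // geq_max sf.
apply: size_div_root => i j; rewrite /affine_map /digit -scalemxAr -colE.
rewrite !mxE ord1; apply: (sD); first apply: (sD) => //.
  by apply: (sC); have := sb i 0; rewrite addn0.
rewrite size_polyN; apply: (sC).
by case: (_ && _); rewrite ?size_poly1 ?size_poly0.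
Qed.

Lemma bounded_exists g : exists2 d, (0 < d)%N & bounded d g.
Proof.
pose d1 := \max_i size (g.1 i ord0).
pose d2 := \max_i \max_j size ((g.2 : 'M_n) i j).
exists (maxn d1 d2).+1 => //; split=> i j.
  rewrite ord1 leqW // leq_max; apply/orP; left.
  exact: (leq_bigmax (F := fun i => size (g.1 i ord0))).
rewrite (leq_trans _ (leq_addr _ _)) // leqW // leq_max; apply/orP; right.
apply: leq_trans (leq_bigmax (F := fun i => \max_j size ((g.2 : 'M_n) i j)) i).
exact: (leq_bigmax (F := fun j => size ((g.2 : 'M_n) i j))).
Qed.

(** Polynomials of size at most [d.+1] over a finite field are encoded by row
    vectors, which form a finite type. *)
Lemma bounded_finite d : finite_set (bounded d).
Proof.
pose T := ('cV['rV['F_p]_d.+1]_n * 'M['rV['F_p]_d.+1]_n)%type.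
pose psi (x : T) : aff :=
  (map_mx rVpoly x.1, insubd (1%g : B_group n p) (map_mx rVpoly x.2)).
apply: (@sub_finite_set _ _ (range psi)); last first.
  by apply: finite_image; apply: finite_finset.
move=> [v b] [/= sv sb].
exists (map_mx poly_rV v, map_mx poly_rV (b : 'M_n)) => //; congr pair => /=.
  by apply/matrixP => i j; rewrite !mxE poly_rV_K // leqW.
rewrite -[RHS](valKd (1%g : B_group n p)); congr insubd.
apply/matrixP => i j; rewrite !mxE poly_rV_K // (leq_trans (sb i j)) //.
by rewrite -[d.+1]addn1 leq_add2l leq_b1.
Qed.

Lemma affine_out_trans a c : exists g, affine_out g a = c.
Proof.
exists (digit (c - a), 1%g).
by rewrite /affine_out /affine_map mul1mx mxE !digit00 hornerD !hornerC subrK.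
Qed.

Lemma dvdp_exp_eq0 (f : Fpx) : (forall r, t ^+ r %| f) -> f = 0.
Proof.
move=> tf; apply/eqP; apply: contraT => nz.
have := dvdp_leq nz (tf (size f)).
by rewrite -polyC1 size_exp_XsubC ltnn.
Qed.

(** [K] stands for the kernel of the tree action. The translation part of [g] in
    [K] is [root_mx] times that of a state, which is in [K] again; so it is
    divisible by [root_mx], and its entries by x - 1, arbitrarily often. *)
Lemma kernel_trivial (K : set aff) :
  (forall g, K g -> affine_out g 0 = 0) ->
  (forall g, K g -> K (affine_st g 0)) ->
  (forall g h, K g -> K (h * g * h^-1)%g) ->
  forall g, K g -> g = 1%g.
Proof.
move=> Kout Kst KJ.
have digit0 : digit 0 = 0 by rewrite /digit scale0r.
have vE g : K g -> g.1 = root_mx *m (affine_st g 0).1.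
  move=> Kg; have := affine_map_branch g 0 0.
  by rewrite /branch (Kout _ Kg) digit0 !add0r /affine_map !mulmx0 !addr0.
(* Going back one coordinate costs one state; a power of x - 1 is gained each
   time coordinate 0 is reached, whence the induction on [r] and then on [i]. *)
have v_dvd r : forall i g, K g -> t ^+ r %| g.1 i 0.
  elim: r => [|r IHr] i; first by move=> g _; rewrite expr0 dvd1p.
  case: i => i; elim: i => [|i IHi] ltin g Kg; rewrite (vE g Kg).
    have -> : Ordinal ltin = ordS ord_max by rewrite ordS_max; apply: val_inj.
    by rewrite mul_root_mx /wt eqxx exprS dvdp_mul // IHr //; apply: Kst.
  have im : Ordinal (ltnW ltin) != ord_max :> 'I_n.
    by rewrite -val_eqE /= ltn_eqF.
  have -> : Ordinal ltin = ordS (Ordinal (ltnW ltin)).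
    by apply: val_inj; exact/esym/(ordS_lt im).
  by rewrite mul_root_mx /wt (negPf im) mul1r IHi //; apply: Kst.
have v0 g : K g -> g.1 = 0.
  move=> Kg; apply/matrixP => i j; rewrite ord1 [RHS]mxE.
  by apply: dvdp_exp_eq0 => r; apply: v_dvd.
move=> g Kg; apply: affine_map_inj => u.
(* The conjugate of [g] by the translation by [u] has translation part
   u - g.2 u. *)
have := v0 _ (KJ g (u, 1%g) Kg).
rewrite /affine_map /= (v0 g Kg) mulmx0 addr0 add0r mul1mx mulNmx mulmxN.
rewrite invmx1 !mul1mx add0r.
by move/eqP; rewrite subr_eq0 => /eqP <-.
Qed.

End Root.

Theorem theoremB (n p : nat) (n_ge3 : (3 <= n)%N) (p_prime : prime p) :
  exists H : set (tree_aut p),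
    [/\ group_closed [in H],
        state_closed H,
        finite_state H,
        transitive_level1 H
      & isomorphic_to_subset (affine n p) H].
Proof.
case: n n_ge3 => // m _.
(* Primality of p identifies the letters, in 'I_p, with the digits, in 'F_p,
   whose carrier is the type of ordinals below (Zp_trunc (pdiv p)).+2. *)
pose to_Fp : 'I_p -> 'F_p := cast_ord (esym (Fp_cast p_prime)).
pose of_Fp : 'F_p -> 'I_p := cast_ord (Fp_cast p_prime).
have of_FpK : cancel of_Fp to_Fp := cast_ordK _.
have to_FpK : cancel to_Fp of_Fp := cast_ordKV _.
pose out (g : affine m.+1 p) i := of_Fp (affine_out g (to_Fp i)).
pose st (g : affine m.+1 p) i := affine_st g (to_Fp i).
have wr : wreath_recursion out st.
  split=> [i|g h i|g h i]; rewrite /out /st.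
  - by rewrite affine_out1 to_FpK.
  - by rewrite of_FpK affine_outM.
  - by rewrite of_FpK affine_stM.
apply: (wreath_recursion_range (wr := wr)).
- apply: kernel_trivial => [g|g|g h] Kg.
  + apply: (can_inj of_FpK).
    by have := act1_out (of_Fp 0) Kg; rewrite /out of_FpK.
  + by have := act1_st (of_Fp 0) Kg; rewrite /st of_FpK.
  + by rewrite !tree_actM Kg mulg1 -tree_actM mulgV tree_act1.
- move=> g; have [d d0 gd] := bounded_exists g; exists (bounded d).
  split=> // [h i|]; first exact: bounded_st.
  exact: bounded_finite.
- move=> i j; have [g gE] := affine_out_trans m (to_Fp i) (to_Fp j).
  by exists g; rewrite /out gE to_FpK.
Qed.
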